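(* Let $I$ be a set. Every $I$-dimensional cylindric ortholattice $A$ is isomorphic (as an $I$-dimensional cylindric ortholattice) to $\mathcal{A}_0(\mathcal{S}_0(A))$ under the map $\phi$, $\phi(a)=\{x\in\mathfrak{F}(A):a\in x\}$.
   Context: An ortholattice is a bounded lattice $\langle A;\wedge,\vee,0,1\rangle$ with a unary operation ${}^{\perp}$ such that $a\wedge a^{\perp}=0$, $a\vee a^{\perp}=1$, $a\le b\Rightarrow b^{\perp}\le a^{\perp}$, and $a^{\perp\perp}=a$. A quantifier on an ortholattice $A$ is a map $\exists\colon A\to A$ with $\exists(a\vee b)=\exists a\vee\exists b$, $\exists 0=0$, $\exists\exists a=\exists a$, $a\le\exists a$, $\exists(\exists a)^{\perp}=(\exists a)^{\perp}$. An $I$-dimensional cylindric ortholattice is an ortholattice $A$ with unary operators $(\exists_i)_{i\in I}$ and constants $(\delta_{i,k})_{i,k\in I}$ such that for all $i,k,l\in I$: (1) $\exists_i$ is a quantifier; (2) $\exists_i\exists_k a=\exists_k\exists_i a$ for all $a\in A$; (3) $\delta_{i,k}=\delta_{k,i}$ and $\delta_{i,i}=1$; (4) if $i\neq k$ and $l\ne k$, then $\exists_k(\delta_{i,k}\wedge\delta_{k,l})=\delta_{i,l}$. Homomorphisms are bounded lattice homomorphisms preserving ${}^\perp$, every $\exists_i$ and every $\delta_{i,k}$. $\mathcal{S}_0(A)=\langle\mathfrak{F}(A);\perp,(R_i)_{i\in I},(\Delta_{i,k})_{i,k\in I},\tau(\beta)\rangle$, where $\mathfrak{F}(A)$ is the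 set of non-empty proper filters of $A$; $x\perp y$ iff there is $a\in x$ with $a^{\perp}\in y$; $xR_iy$ iff $\{\exists_ia:a\in x\}\subseteq y$; $\Delta_{i,k}=\phi(\delta_{i,k})$; and $\tau(\beta)$ is the topology with basis $\{\phi(a):a\in A\}$. For a topological space $X$ with an irreflexive symmetric relation $\perp$, relations $R_i$ and subsets $\Delta_{i,k}$: $U^{\perp}=\{x:x\perp y\text{ for all }y\in U\}$, $R[U]=\{y:xRy\text{ for some }x\in U\}$, $U\sqcup V=(U\cup V)^{\perp\perp}$, $\exists_RU=R[U]^{\perp\perp}$; $\mathcal{COB}(X)$ is the set of compact open $U\subseteq X$ with $U=U^{\perp\perp}$; and $\mathcal{A}_0(X)=\langle\mathcal{COB}(X);\cap,\sqcup,{}^{\perp},\emptyset,X,(\exists_{R_i})_{i\in I},(\Delta_{i,k})_{i,k\in I}\rangle$. *)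

(* Defs.v *)
From HB Require Import structures.
From mathcomp Require Import all_boot all_order.
From mathcomp Require Import boolp classical_sets topology.

Set Implicit Arguments.
Unset Strict Implicit.
Unset Printing Implicit Defensive.

Import Order.Theory.
Local Open Scope order_scope.

HB.mixin Record isOrthoLattice (d : Order.disp_t) A
    & Order.TBLattice d A := {
  orth : A -> A;
  meet_orth : forall a : A, a `&` orth a = \bot;
  join_orth : forall a : A, a `|` orth a = \top;
  orth_anti : forall a b : A, a <= b -> orth b <= orth a;
  orthK : involutive orth
}.

#[short(type="orthoLatticeType")]
HB.structure Definition OrthoLattice (d : Order.disp_t) :=
  {A of isOrthoLattice d A & Order.TBLattice d A}.

Record quantifier (d : Order.disp_t) (A : orthoLatticeType d) (e : A -> A) :
    Prop := {
  quantifier_join : forall a b, e (a `|` b) = e a `|` e b;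
  quantifier_bot : e \bot = \bot;
  quantifier_idem : forall a, e (e a) = e a;
  quantifier_le : forall a, a <= e a;
  quantifier_orth : forall a, e (orth (e a)) = orth (e a)
}.

Record cylindric (I : Type) (d : Order.disp_t) (A : orthoLatticeType d)
    (ex : I -> A -> A) (delta : I -> I -> A) : Prop := {
  cylindric_quantifier : forall i, quantifier (ex i);
  cylindric_comm : forall i k a, ex i (ex k a) = ex k (ex i a);
  cylindric_sym : forall i k, delta i k = delta k i;
  cylindric_refl : forall i, delta i i = \top;
  cylindric_trans : forall i k l, i <> k -> l <> k ->
    ex k (delta i k `&` delta k l) = delta i l
}.

HB.mixin Record isCylindric (I : Type) (d : Order.disp_t) A
    & OrthoLattice d A := {
  cyl_ex : I -> A -> A;
  cyl_delta : I -> I -> A;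
  cylP : cylindric cyl_ex cyl_delta
}.

#[short(type="cylOrthoLatticeType")]
HB.structure Definition CylOrthoLattice (I : Type) (d : Order.disp_t) :=
  {A of isCylindric I d A & OrthoLattice d A}.

Record cyl_homomorphism (I : Type) (d d' : Order.disp_t)
    (A : cylOrthoLatticeType I d) (B : cylOrthoLatticeType I d') (f : A -> B) :
    Prop := {
  cyl_hom_meet : Order.meet_morphism f;
  cyl_hom_join : Order.join_morphism f;
  cyl_hom_bot : f \bot = \bot;
  cyl_hom_top : f \top = \top;
  cyl_hom_orth : {morph f : a / orth a};
  cyl_hom_ex : forall i, {morph f : a / cyl_ex (i : I) a};
  cyl_hom_delta : forall i k : I, f (cyl_delta i k) = cyl_delta i k
}.

Definition cyl_isomorphism (I : Type) (d d' : Order.disp_t)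
    (A : cylOrthoLatticeType I d) (B : cylOrthoLatticeType I d') (f : A -> B) :
    Prop :=
  cyl_homomorphism f /\ bijective f.

(* Carrier spaces need not be pointed: the filter space of the one-element
   ortholattice is empty. *)
HB.mixin Record isCylOrthoSpace (I : Type) X & Topological X := {
  sp_perp : X -> X -> Prop;
  sp_perp_irr : forall x, ~ sp_perp x x;
  sp_perp_sym : forall x y, sp_perp x y -> sp_perp y x;
  sp_rel : I -> X -> X -> Prop;
  sp_Delta : I -> I -> set X
}.

#[short(type="cylOrthoSpaceType")]
HB.structure Definition CylOrthoSpace (I : Type) :=
  {X of isCylOrthoSpace I X & Topological X}.

Local Close Scope order_scope.
Local Open Scope classical_set_scope.

Section SetOperations.
Variables (I : Type) (X : cylOrthoSpaceType I).
Implicit Types U V : set X.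

Definition perpset U : set X := [set x | forall y, U y -> sp_perp x y].

Definition rel_image (R : X -> X -> Prop) U : set X :=
  [set y | exists2 x, U x & R x y].

Definition sqcup U V : set X := perpset (perpset (U `|` V)).

Definition ex_rel (R : X -> X -> Prop) U : set X :=
  perpset (perpset (rel_image R U)).

Definition cob : set (set X) :=
  [set U | [/\ compact U, open U & U = perpset (perpset U)]].

Record cob_closed : Prop := {
  cob_set0 : cob set0;
  cob_setT : cob setT;
  cob_setI : forall U V, cob U -> cob V -> cob (U `&` V);
  cob_sqcup : forall U V, cob U -> cob V -> cob (sqcup U V);
  cob_perpset : forall U, cob U -> cob (perpset U);
  cob_ex_rel : forall i U, cob U -> cob (ex_rel (sp_rel i) U);
  cob_Delta : forall i k, cob (sp_Delta i k)
}.

Lemma perpset_anti U V : U `<=` V -> perpset V `<=` perpset U.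
Proof. by move=> UV x xV y /UV /xV. Qed.

Lemma sub_perpset2 U : U `<=` perpset (perpset U).
Proof. by move=> x Ux y; move/(_ x Ux); exact: sp_perp_sym. Qed.

End SetOperations.

Arguments cob {I} X _.
Arguments cob_closed {I} X.

(* On an arbitrary space the operations need not preserve [cob X], so the
   algebra takes the proof that they do as an argument. *)
Definition A0 (I : Type) (X : cylOrthoSpaceType I) (H : cob_closed X) : Type :=
  set_type (cob X).

Section A0Ortholattice.
Variables (I : Type) (X : cylOrthoSpaceType I) (H : cob_closed X).

HB.instance Definition _ := Choice.on (A0 H).
HB.instance Definition _ := SubChoice.on (A0 H).
HB.instance Definition _ := [SubChoice_isSubPOrder of A0 H by <: with set_display].

Implicit Types u v w : A0 H.

Lemma A0P u : cob X (val u).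
Proof. exact: set_valP. Qed.

Definition mkA0 (U : set X) (HU : cob X U) : A0 H := exist _ U (mem_set HU).

Definition A0_meet u v : A0 H := mkA0 (cob_setI H (A0P u) (A0P v)).
Definition A0_join u v : A0 H := mkA0 (cob_sqcup H (A0P u) (A0P v)).
Definition A0_orth u : A0 H := mkA0 (cob_perpset H (A0P u)).
Definition A0_bot : A0 H := mkA0 (cob_set0 H).
Definition A0_top : A0 H := mkA0 (cob_setT H).
Definition A0_ex (i : I) u : A0 H := mkA0 (cob_ex_rel H i (A0P u)).
Definition A0_delta (i k : I) : A0 H := mkA0 (cob_Delta H i k).

Lemma A0_leP u v : (u <= v)%O <-> val u `<=` val v.
Proof. by rewrite subsetEset. Qed.

Lemma A0_regular u : val u = perpset (perpset (val u)).
Proof. by case: (A0P u). Qed.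

Lemma A0_meetP u v w :
  (u <= A0_meet v w)%O = (u <= v)%O && (u <= w)%O.
Proof.
apply/idP/andP => [/A0_leP uvw | [/A0_leP uv /A0_leP uw]].
  by split; apply/A0_leP => x /uvw [].
by apply/A0_leP => x ux; split; [exact: uv|exact: uw].
Qed.

Lemma A0_joinP u v w :
  (A0_join u v <= w)%O = (u <= w)%O && (v <= w)%O.
Proof.
apply/idP/andP => [/A0_leP uvw | [/A0_leP uw /A0_leP vw]].
  by split; apply/A0_leP => x ?; apply/uvw/sub_perpset2; [left|right].
apply/A0_leP; rewrite [val w]A0_regular.
by apply/perpset_anti/perpset_anti => x [/uw|/vw].
Qed.

Lemma A0_botP u : (A0_bot <= u)%O.
Proof. by apply/A0_leP. Qed.

Lemma A0_topP u : (u <= A0_top)%O.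
Proof. by apply/A0_leP. Qed.

HB.instance Definition _ :=
  Order.POrder_MeetJoin_isLattice.Build _ (A0 H) A0_meetP A0_joinP.
HB.instance Definition _ := Order.hasBottom.Build _ (A0 H) A0_botP.
HB.instance Definition _ := Order.hasTop.Build _ (A0 H) A0_topP.

Lemma A0_meet_orth u : (u `&` A0_orth u = \bot)%O.
Proof.
apply/val_inj/seteqP; split=> x //= -[ux /(_ _ ux)]; exact: sp_perp_irr.
Qed.

Lemma A0_join_orth u : (u `|` A0_orth u = \top)%O.
Proof.
apply/val_inj/seteqP; split=> x //= _ y Vy; exfalso.
apply: (@sp_perp_irr _ X y); apply: (Vy y); right => z uz.
by apply: Vy; left.
Qed.

Lemma A0_orth_anti u v : (u <= v)%O -> (A0_orth v <= A0_orth u)%O.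
Proof. by move=> /A0_leP uv; apply/A0_leP/perpset_anti. Qed.

Lemma A0_orthK : involutive A0_orth.
Proof. by move=> u; apply/val_inj; rewrite [RHS]A0_regular. Qed.

HB.instance Definition _ := isOrthoLattice.Build _ (A0 H)
  A0_meet_orth A0_join_orth A0_orth_anti A0_orthK.

End A0Ortholattice.

Arguments A0_ex {I X} H i u.
Arguments A0_delta {I X} H i k.

Definition A0_cyl (I : Type) (X : cylOrthoSpaceType I) (H : cob_closed X)
  (L : cylindric (A0_ex H) (A0_delta H)) : Type := A0 H.

HB.instance Definition _ (I : Type) (X : cylOrthoSpaceType I)
  (H : cob_closed X) (L : cylindric (A0_ex H) (A0_delta H)) :=
  OrthoLattice.on (A0_cyl L).
HB.instance Definition _ (I : Type) (X : cylOrthoSpaceType I)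
  (H : cob_closed X) (L : cylindric (A0_ex H) (A0_delta H)) :=
  SubChoice.on (A0_cyl L).
HB.instance Definition _ (I : Type) (X : cylOrthoSpaceType I)
  (H : cob_closed X) (L : cylindric (A0_ex H) (A0_delta H)) :=
  isCylindric.Build I _ (A0_cyl L) L.

Record lfilter (d : Order.disp_t) (A : orthoLatticeType d) := LFilter {
  lfilter_set : set A;
  lfilter_nonempty : lfilter_set !=set0;
  lfilter_up : forall a b, (a <= b)%O -> lfilter_set a -> lfilter_set b;
  lfilter_meet : forall a b,
    lfilter_set a -> lfilter_set b -> lfilter_set (a `&` b)%O;
  lfilter_proper : lfilter_set <> setT
}.

HB.instance Definition _ (d : Order.disp_t) (A : orthoLatticeType d) :=
  gen_eqMixin (lfilter A).
HB.instance Definition _ (d : Order.disp_t) (A : orthoLatticeType d) :=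
  gen_choiceMixin (lfilter A).

Definition phi (d : Order.disp_t) (A : orthoLatticeType d) (a : A) :
  set (lfilter A) := [set x | lfilter_set x a].

Section LFilterTopology.
Variables (d : Order.disp_t) (A : orthoLatticeType d).

Lemma phi_cover : \bigcup_(U in range (@phi d A)) U = setT.
Proof.
apply/seteqP; split=> x // _; have [a xa] := lfilter_nonempty x.
by exists (phi a) => //; exists a.
Qed.

Lemma phi_base (U V : set (lfilter A)) x :
    range (@phi d A) U -> range (@phi d A) V -> U x -> V x ->
  exists W, [/\ range (@phi d A) W, W x & W `<=` U `&` V].
Proof.
move=> [a _ <-] [b _ <-] xa xb; exists (phi (a `&` b)%O); split.
- by exists (a `&` b)%O.
- exact: lfilter_meet.
- move=> y yab; split; apply: (lfilter_up _ yab); [exact: leIl|exact: leIr].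
Qed.

HB.instance Definition _ :=
  isBaseTopological.Build (lfilter A) phi_cover phi_base.

Lemma open_lfilterE :
  open = [set \bigcup_(U in B) U | B in [set B | B `<=` range (@phi d A)]].
Proof. by []. Qed.

End LFilterTopology.

Section FilterSpace.
Variables (I : Type) (d : Order.disp_t) (A : cylOrthoLatticeType I d).
Implicit Types x y : lfilter A.

Definition lfilter_perp x y : Prop :=
  exists2 a, lfilter_set x a & lfilter_set y (orth a).

Lemma lfilter_perp_irr x : ~ lfilter_perp x x.
Proof.
move=> [a xa xa']; apply: (@lfilter_proper _ _ x); apply/seteqP; split=> b //.
move=> _; apply: (@lfilter_up _ _ x \bot%O); first exact: le0x.
by rewrite -(meet_orth a); exact: lfilter_meet.
Qed.

Lemma lfilter_perp_sym x y : lfilter_perp x y -> lfilter_perp y x.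
Proof. by move=> [a xa ya]; exists (orth a) => //; rewrite orthK. Qed.

Definition lfilter_rel (i : I) x y : Prop :=
  [set cyl_ex i a | a in lfilter_set x] `<=` lfilter_set y.

HB.instance Definition _ := isCylOrthoSpace.Build I (lfilter A)
  lfilter_perp_irr lfilter_perp_sym lfilter_rel
  (fun i k => phi (cyl_delta i k : A)).

Definition S0 : cylOrthoSpaceType I := lfilter A.

End FilterSpace.

(* Main.v *)
Require Import Defs.
From mathcomp Require Import all_boot all_order.
From mathcomp Require Import boolp classical_sets topology.

(** Everything rests on the principal filters.  For [a != 0] the up-set of [a]
    is the least point of [phi a], so a statement about all points of [phi a]
    can be tested on that one filter.  This yields injectivity of [phi] (test
    [phi a `<=` phi b] on the up-set of [a]), the identity
    [(phi a)^perp = phi (a^perp)], and the identity [R_i[phi a] = phi (ex_i a)],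
    which holds before any closure is taken: a filter containing [ex_i a] is
    [R_i]-related to the up-set of [a] because [ex_i] is monotone.  It also
    yields compactness: a neighbourhood of the least point of [phi a] contains
    all of [phi a], so every filter on [phi a] clusters there.

    For the range of [phi], let [U] be compact, open and regular.  The elements
    [a] with [phi a `<=` U] are closed under joins, since
    [phi (a `|` b) = (phi a `|` phi b)^perp^perp] and [U] is regular.  Hence the
    open set [U] is a directed union of sets [phi a], and by compactness it
    equals one of them.

    So [cob] is exactly the range of [phi], and [phi] carries each operation of
    [A] to the corresponding set operation.  The closure properties of [cob] and
    the cylindric axioms are therefore inherited from [A] along [phi]. *)

Set Implicit Arguments.
Unset Strict Implicit.
Unset Printing Implicit Defensive.

Import Order.Theory.
Local Open Scope classical_set_scope.

Section Ortholattices.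
Variables (d : Order.disp_t) (A : orthoLatticeType d).
Implicit Types (a b : A) (x : lfilter A).

Lemma orth_bot : orth (\bot : A)%O = \top%O.
Proof. by rewrite -[LHS]join0x join_orth. Qed.

Lemma orth_le a b : (orth a <= orth b)%O = (b <= a)%O.
Proof. by apply/idP/idP => /orth_anti //; rewrite !orthK. Qed.

Lemma le_orthC a b : (a <= orth b)%O = (b <= orth a)%O.
Proof. by rewrite -orth_le orthK. Qed.

Lemma orth_join a b : orth (a `|` b)%O = (orth a `&` orth b)%O.
Proof.
apply/le_anti; rewrite lexI !orth_anti ?leUl ?leUr //=.
by rewrite le_orthC leUx !(le_orthC _ (_ `&` _)%O) leIl leIr.
Qed.

Lemma quantifier_mono (e : A -> A) : quantifier e -> {homo e : a b / (a <= b)%O}.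
Proof.
by move=> qe a b /join_idPr ab; rewrite -ab quantifier_join // leUl.
Qed.

Lemma lfilter_bot x : ~ lfilter_set x \bot%O.
Proof.
move=> x0; apply: (@lfilter_proper _ _ x); apply/seteqP; split=> // b _.
exact: lfilter_up x0.
Qed.

Lemma lfilter_top x : lfilter_set x \top%O.
Proof. by have [a xa] := lfilter_nonempty x; exact: lfilter_up xa. Qed.

Lemma lfilterI x a b :
  lfilter_set x (a `&` b)%O <-> lfilter_set x a /\ lfilter_set x b.
Proof.
split=> [xab|[xa xb]]; last exact: lfilter_meet.
by split; apply: lfilter_up xab; [exact: leIl|exact: leIr].
Qed.

Lemma principal_lfilter a : a != \bot%O ->
  {x : lfilter A | lfilter_set x = [set b | (a <= b)%O]}.
Proof.
move=> a0; have h1 : [set b | (a <= b)%O] !=set0 by exists a => /=.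
have h2 b c : (b <= c)%O -> (a <= b)%O -> (a <= c)%O.
  by move=> bc ab; exact: le_trans bc.
have h3 b c : (a <= b)%O -> (a <= c)%O -> (a <= b `&` c)%O.
  by move=> ab ac; rewrite lexI ab.
have h4 : [set b | (a <= b)%O] <> setT.
  move=> /seteqP[_ /(_ \bot%O I)] /=; rewrite lex0; exact/negP.
by exists (LFilter h1 h2 h3 h4).
Qed.

Lemma sub_phi a b : phi a `<=` phi b <-> (a <= b)%O.
Proof.
split=> [|ab x]; last exact: lfilter_up.
have [->|/principal_lfilter[p pE]] := eqVneq a \bot%O; first by rewrite le0x.
by move=> /(_ p); rewrite /phi /= pE => /(_ (lexx a)).
Qed.

Lemma phi_inj : injective (@phi d A).
Proof.
by move=> a b E; apply/le_anti/andP; split; apply/sub_phi; rewrite E.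
Qed.

Lemma phi_bot : phi \bot%O = set0 :> set (lfilter A).
Proof. by apply/seteqP; split=> // x /lfilter_bot. Qed.

Lemma phi_top : phi \top%O = setT :> set (lfilter A).
Proof. by apply/seteqP; split=> // x _; exact: lfilter_top. Qed.

Lemma phi_meet a b : phi (a `&` b)%O = phi a `&` phi b.
Proof. by apply/seteqP; split=> x /lfilterI. Qed.

Lemma open_phi a : open (phi a).
Proof.
rewrite open_lfilterE; exists [set phi a]; last by rewrite bigcup_set1.
by move=> _ ->; exists a.
Qed.

Lemma open_sub_phi (U : set (lfilter A)) x : open U -> U x ->
  exists2 a, phi a x & phi a `<=` U.
Proof.
rewrite open_lfilterE => -[B BP <-] [V BV Vx].
by have [a _ aV] := BP _ BV; exists a; rewrite aV // => y Vy; exists V.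
Qed.

(** The least point of [phi a] is a cluster point of every filter on [phi a],
    because each of its neighbourhoods contains [phi a]. *)
Lemma compact_phi a : compact (phi a).
Proof.
move=> F PF Fa.
have [a0|/principal_lfilter[p pE]] := eqVneq a \bot%O.
  by move: Fa; rewrite a0 phi_bot => /filter_not_empty.
exists p; split; first by rewrite /phi /= pE /=.
move=> B V FB; rewrite nbhsE => -[W [Wo Wp] WV].
have [b bp bW] := open_sub_phi Wo Wp.
have [y [By ya]] := filter_ex (filterI FB Fa).
exists y; split=> //; apply/WV/bW.
by move: bp; rewrite /phi /= pE => ab; exact: lfilter_up ya.
Qed.

End Ortholattices.

Section FilterSpaceOperations.
Variables (I : Type) (d : Order.disp_t) (A : cylOrthoLatticeType I d).
Implicit Types (a b : A) (U : set (S0 A)).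

(** A filter orthogonal to the up-set of [a] contains some [b] with
    [a <= orth b], hence it contains [orth a]. *)
Lemma perpset_phi a : perpset (phi a : set (S0 A)) = phi (orth a).
Proof.
apply/seteqP; split=> x; last by move=> xa y ya; exists (orth a); rewrite ?orthK.
have [->|/principal_lfilter[p pE]] := eqVneq a \bot%O.
  by rewrite orth_bot phi_top.
move=> /(_ p); rewrite /phi /= pE => /(_ (lexx a)) [b xb].
by rewrite pE /= => ab; apply: lfilter_up xb; rewrite -orth_le orthK.
Qed.

Lemma perpsetU U V : perpset (U `|` V) = perpset U `&` perpset V.
Proof.
apply/seteqP; split=> [x h|x [hU hV] y [/hU|/hV] //].
by split=> y ?; apply: h; [left|right].
Qed.

Lemma sqcup_phi a b : sqcup (phi a : set (S0 A)) (phi b) = phi (a `|` b)%O.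
Proof.
by rewrite /sqcup perpsetU !perpset_phi -phi_meet -orth_join perpset_phi orthK.
Qed.

(** If [y] contains [ex_i a], the up-set of [a] is [R_i]-related to [y] since
    [ex_i] is monotone; the relational image is thus already regular. *)
Lemma rel_image_phi i a :
  rel_image (sp_rel i) (phi a : set (S0 A)) = phi (cyl_ex i a).
Proof.
have qe := cylindric_quantifier (@cylP I d A) i.
apply/seteqP; split=> [y [x xa xy]|y ya]; first by apply: xy; exists a.
have [a0|/principal_lfilter[p pE]] := eqVneq a \bot%O.
  by move: ya; rewrite a0 (quantifier_bot qe) phi_bot.
exists p; first by rewrite /phi /= pE /=.
move=> _ [b + <-]; rewrite pE /= => /(quantifier_mono qe) ab.
exact: lfilter_up ya.
Qed.

Lemma ex_rel_phi i a :
  ex_rel (sp_rel i) (phi a : set (S0 A)) = phi (cyl_ex i a).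
Proof. by rewrite /ex_rel rel_image_phi !perpset_phi orthK. Qed.

Lemma cob_phi a : cob (S0 A) (phi a).
Proof.
split; [exact: compact_phi|exact: open_phi|].
by rewrite !perpset_phi orthK.
Qed.

(** The elements [a] with [phi a `<=` U] are directed under joins because [U] is
    regular, and they index a cover of the open set [U]; compactness then lets
    a single one of them cover [U]. *)
Lemma cob_is_phi U : cob (S0 A) U -> exists a, phi a = U.
Proof.
move=> [Uc Uo Ur].
pose D := [set a | (phi a : set (S0 A)) `<=` U].
have D0 : D \bot%O by rewrite /D /= phi_bot.
have DU a b : D a -> D b -> D (a `|` b)%O.
  move=> Da Db; rewrite /D /= -sqcup_phi Ur.
  by apply/perpset_anti/perpset_anti => x [/Da|/Db].
(* The filter of tails of [D]: a property that holds near it holds at some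
   member of [D]. *)
pose F : set_system A :=
  [set V | exists2 a, D a & forall b, D b -> (a <= b)%O -> V b].
have FF : Filter F.
  split; first by exists \bot%O.
  - move=> P Q [a Da aP] [b Db bQ]; exists (a `|` b)%O; first exact: DU.
    by move=> c Dc; rewrite leUx => /andP[ac bc]; split; [exact: aP|exact: bQ].
  - by move=> P Q PQ [a Da aP]; exists a => // b Db ab; apply/PQ/aP.
have [|a Da /(_ a Da (lexx a)) Ua] :=
    (compact_near_coveringP U).1 Uc A F (fun a x => phi a x) FF.
  move=> x Ux; have [a ax aU] := open_sub_phi Uo Ux.
  exists (phi a, [set b | (a <= b)%O]).
    split=> /=; last by exists a.
    by apply: open_nbhs_nbhs; split => //; exact: open_phi.
  by move=> [y b] [/= ya ab]; exact: lfilter_up ya.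
by exists a; apply/seteqP; split.
Qed.

Lemma S0_cob_closed : cob_closed (S0 A).
Proof.
split.
- by rewrite -phi_bot; exact: cob_phi.
- by rewrite -phi_top; exact: cob_phi.
- move=> _ _ /cob_is_phi[a <-] /cob_is_phi[b <-].
  by rewrite -phi_meet; exact: cob_phi.
- move=> _ _ /cob_is_phi[a <-] /cob_is_phi[b <-].
  by rewrite sqcup_phi; exact: cob_phi.
- by move=> _ /cob_is_phi[a <-]; rewrite perpset_phi; exact: cob_phi.
- by move=> i _ /cob_is_phi[a <-]; rewrite ex_rel_phi; exact: cob_phi.
- by move=> i k; exact: cob_phi.
Qed.

End FilterSpaceOperations.

(** The axioms of a cylindric ortholattice are equational, apart from
    [a <= ex_i a], which becomes an equation once written with a join; so they
    pass to homomorphic images. *)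
Lemma cylindric_surj (I : Type) (d d' : Order.disp_t)
    (A : orthoLatticeType d) (B : orthoLatticeType d')
    (eA : I -> A -> A) (dA : I -> I -> A) (eB : I -> B -> B) (dB : I -> I -> B)
    (f : A -> B) :
    Order.meet_morphism f -> Order.join_morphism f ->
    f \bot%O = \bot%O -> f \top%O = \top%O -> {morph f : a / orth a} ->
    (forall i a, f (eA i a) = eB i (f a)) ->
    (forall i k, f (dA i k) = dB i k) ->
    (forall u, exists a, f a = u) ->
  cylindric eA dA -> cylindric eB dB.
Proof.
move=> fI fU f0 f1 fC fe fd fs [qA cA sA rA tA].
split=> [i|i k u|i k|i|i k l ik lk].
- have [qU q0 qq qle qC] := qA i; split=> [u v||u|u|u].
  + have [[a <-] [b <-]] := (fs u, fs v).
    by rewrite -fU -!fe qU fU.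
  + by rewrite -f0 -fe q0.
  + by have [a <-] := fs u; rewrite -!fe qq.
  + have [a <-] := fs u; apply/join_idPr.
    by rewrite -fe -fU; congr f; apply/join_idPr/qle.
  + by have [a <-] := fs u; rewrite -fe -fC -fe qC.
- by have [a <-] := fs u; rewrite -!fe cA.
- by rewrite -!fd sA.
- by rewrite -fd rA.
- by rewrite -!fd -fI -fe tA.
Qed.

Theorem theorem5p8 (I : Type) (d : Order.disp_t)
    (A : cylOrthoLatticeType I d) :
  exists (H : cob_closed (S0 A))
         (L : cylindric (A0_ex H) (A0_delta H))
         (f : A -> A0_cyl L),
    cyl_isomorphism f /\ (forall a : A, val (f a) = phi a).
Proof.
pose H := S0_cob_closed A; pose f a : A0 H := mkA0 H (cob_phi a).
have fI : Order.meet_morphism f.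
  by move=> a b; apply/val_inj; exact: phi_meet.
have fU : Order.join_morphism f.
  by move=> a b; apply/val_inj; rewrite /= -sqcup_phi.
have f0 : f \bot%O = \bot%O by apply/val_inj; exact: phi_bot.
have f1 : f \top%O = \top%O by apply/val_inj; exact: phi_top.
have fC : {morph f : a / orth a}.
  by move=> a; apply/val_inj; rewrite /= -perpset_phi.
have fe i a : f (cyl_ex i a) = A0_ex H i (f a).
  by apply/val_inj; rewrite /= -ex_rel_phi.
have fd i k : f (cyl_delta i k) = A0_delta H i k by exact/val_inj.
have fs u : exists a, f a = u.
  by have [a au] := cob_is_phi (A0P u); exists a; exact/val_inj.
pose L := cylindric_surj fI fU f0 f1 fC fe fd fs (@cylP I d A).
exists H, L, f; split=> //; split; first by split.
have [g gK] := choice fs.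
by exists g => // a; apply/phi_inj; exact: (congr1 val (gK (f a))).
Qed.
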